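(* Let $(S,\Sigma)$ be a measurable space, let $\mathcal{P}$ be the class of all probability measures on $(S,\Sigma)$, and let $H$ be a class of real-valued functions on $S$, each integrable with respect to every $P\in\mathcal{P}$, containing at least one non-constant function. Suppose $H$ is a weak uniform Glivenko-Cantelli class, i.e. for every $\epsilon>0$ $$\lim_{n\to\infty}\ \sup_{P\in\mathcal{P}} P^n\{\|P_n-P\|_H^*>\epsilon\}=0 .$$ Then $H$ is a strong uniform Glivenko-Cantelli class, i.e. for every $\epsilon>0$ $$\lim_{n\to\infty}\ \sup_{P\in\mathcal{P}} P^{\infty}\Big\{\sup_{k\ge n}\|P_k-P\|_H^*>\epsilon\Big\}=0 .$$
   Context: For $P\in\mathcal{P}$ and $n\in\mathbb{N}$ (positive integers), $(S^n,\Sigma^n,P^n)$ denotes the $n$-fold product probability space and $(S^\infty,\Sigma^\infty,P^\infty)$ the countably infinite product. The i.i.d. samples from $P$ are the coordinate functions, and the empirical probability at $s=(s_1,\dots,s_n)$ is $P_n=\frac1n\sum_{i=1}^n\delta_{s_i}$. For a probability measure $Q$ and a function $f$, $Q(f)=\int f\,dQ$, so $P_n(f)=\frac1n\sum_{i=1}^n f(s_i)$. For a real-valued functional $F$ defined on $H$, $\|F\|_H=\sup_{f\in H}|F(f)|$; thus $\|P_n-P\|_H=\sup_{f\in H}|P_n(f)-P(f)|$, a (not necessarily measurable) $[0,\infty]$-valued function on $S^n$. An asterisk denotes the measurable cover function: for a probability space $(\Omega,\mathcal{A},Q)$ and an arbitrary function $g:\Omega\to[-\infty,\infty]$, $g^*:\Omega\to[-\infty,\infty]$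 is an $\mathcal{A}$-measurable function with $g^*\ge g$ everywhere and such that $g^*\le h$ $Q$-almost surely for every $\mathcal{A}$-measurable $h:\Omega\to[-\infty,\infty]$ with $h\ge g$ $Q$-almost surely. It exists and is unique up to $Q$-almost sure equality. The cover $\|P_n-P\|_H^*$ is taken with respect to $(S^n,\Sigma^n,P^n)$. In events on $S^\infty$, $\|P_k-P\|_H^*$ is regarded as a function on $S^\infty$ through the projection onto the first $k$ coordinates. *)

(* Defs.v *)
From HB Require Import structures.
From mathcomp Require Import all_boot all_order all_algebra.
From mathcomp Require Import all_classical all_reals all_analysis.
From mathcomp Require Import measurable_realfun.

Set Implicit Arguments.
Unset Strict Implicit.
Unset Printing Implicit Defensive.

Import Order.TTheory GRing.Theory Num.Theory.
Import numFieldNormedType.Exports.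

Local Open Scope classical_set_scope.
Local Open Scope ring_scope.

Section finite_power.
Context {d} {S : measurableType d} {R : realType}.
Local Open Scope ereal_scope.

Definition cons_pair n (p : S * n.-tuple S) : n.+1.-tuple S :=
  [tuple of p.1 :: p.2].

Lemma measurable_cons_pair n :
  measurable_fun [set: S * n.-tuple S] (@cons_pair n).
Proof. exact: measurable_cons. Qed.

HB.instance Definition _ n := isMeasurableFun.Build _ _ _ _ (@cons_pair n)
  (@measurable_cons_pair n).

(* [P^n] on [n.-tuple S]: [P^0] is the point mass at the empty tuple and
   [P^(n+1)] is the image of [P \x P^n] under [(x, t) |-> x :: t]. *)
Fixpoint tuple_power (P : probability S R) n : probability (n.-tuple S) R :=
  match n with
  | 0%N => \d_[tuple]
  | n.+1 => distribution (P \x tuple_power P n) (@cons_pair n)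
  end.

Lemma tuple_power0 P (B : set (0.-tuple S)) : tuple_power P 0 B = (\1_B [tuple])%:E.
Proof. by rewrite /= diracE indicE. Qed.

Lemma tuple_powerS P n (B : set (n.+1.-tuple S)) : measurable B ->
  tuple_power P n.+1 B = \int[P]_x tuple_power P n [set t | B (cons_pair (x, t))].
Proof.
move=> mB /=; rewrite /distribution /pushforward /product_measure1.
apply: eq_integral => x _ /=; congr (tuple_power P n _).
by apply/seteqP; split => t /=; rewrite /xsection/= inE.
Qed.

Lemma measurable_tuple_section n (B : set (n.+1.-tuple S)) x : measurable B ->
  measurable [set t | B (cons_pair (x, t))].
Proof.
move=> mB; rewrite -[X in measurable X]setTI.
have mf : measurable_fun setT (fun t : n.-tuple S => cons_pair (x, t)).
  by apply: (@measurable_cons _ _ _ _ (cst x) _ id).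
exact: mf.
Qed.

Lemma measurable_tuple_power_section P n (B : set (n.+1.-tuple S)) : measurable B ->
  measurable_fun [set: S]
    (fun x => tuple_power P n [set t | B (cons_pair (x, t))]).
Proof.
move=> mB.
have mC : measurable (@cons_pair n @^-1` B).
  by rewrite -[X in measurable X]setTI; exact: measurable_cons_pair.
have := measurable_fun_xsection (tuple_power P n) mC.
congr (measurable_fun _ _); apply/funext => x /=; congr (tuple_power P n _).
by apply/seteqP; split => t /=; rewrite /xsection/= inE.
Qed.

Lemma measurable_rect n (A : 'I_n -> set S) : (forall i, measurable (A i)) ->
  measurable [set t : n.-tuple S | forall i, A i (tnth t i)].
Proof.
move=> mA.
rewrite (_ : [set _ | _] = \bigcap_(i in [set: 'I_n]) (@tnth _ S ^~ i @^-1` A i)).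
  apply: fin_bigcap_measurable => // i _.
  by rewrite -[X in measurable X]setTI; exact: measurable_tnth.
by apply/seteqP; split => t /= h i; [move=> _; exact: h | exact: (h i)].
Qed.

Lemma tuple_power_rect P n (A : 'I_n -> set S) : (forall i, measurable (A i)) ->
  tuple_power P n [set t | forall i, A i (tnth t i)] = \prod_(i < n) P (A i).
Proof.
elim: n A => [|n IH] A mA.
  rewrite tuple_power0 big_ord0 indicE mem_set//= => i; by case: i.
have mB := measurable_rect mA.
rewrite tuple_powerS// big_ord_recl.
rewrite (eq_integral (fun x => (\1_(A ord0) x)%:E * \prod_(i < n) P (A (lift ord0 i)))).
  rewrite ge0_integralZr//.
  - by rewrite integral_indic// setIT.
  - by apply/measurable_EFinP; exact: measurable_indic.
  - by apply: prode_ge0 => i _.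
move=> x _; rewrite -IH//.
have [Ax|nAx] := pselect (A ord0 x); last first.
  rewrite indicE memNset// mul0e -[RHS](measure0 (tuple_power P n)).
  congr (tuple_power P n _); rewrite -subset0 => t /= /(_ ord0).
  by rewrite (tnth_nth point)/=.
rewrite indicE mem_set// mul1e; congr (tuple_power P n _).
apply/seteqP; split => t /= h i.
  by have := h (lift ord0 i); rewrite /cons_pair tnthS.
have [->|] := eqVneq i ord0; first by rewrite tnth0.
by rewrite eq_sym => /unlift_some[j -> _]; rewrite tnthS; exact: h.
Qed.

End finite_power.

Section cylinders.
Context {d} {S : measurableType d}.
Implicit Types (w : nat -> S) (A : set (nat -> S)).

Definition prefix n w : n.-tuple S := [tuple w i | i < n].

Definition level n A :=
  exists2 B : set (n.-tuple S), measurable B & A = prefix n @^-1` B.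

Definition cylinder A := exists n, level n A.

Definition scons x w : nat -> S := fun n => if n is m.+1 then w m else x.

Definition ssection A x := [set w | A (scons x w)].

Lemma prefix_scons n x w : prefix n.+1 (scons x w) = cons_pair (x, prefix n w).
Proof.
apply: eq_from_tnth => i; rewrite tnth_mktuple.
have [->|] := eqVneq i ord0; first by rewrite tnth0.
rewrite eq_sym => /unlift_some[j -> _].
by rewrite /cons_pair tnthS tnth_mktuple.
Qed.

Lemma prefix_surj n (t : n.-tuple S) : exists w, prefix n w = t.
Proof.
exists (nth point t); apply: eq_from_tnth => i.
by rewrite tnth_mktuple (tnth_nth point).
Qed.

Lemma preimage_prefix_inj n (B C : set (n.-tuple S)) :
  prefix n @^-1` B = prefix n @^-1` C -> B = C.
Proof.
move=> BC; apply/seteqP; split => t; have [w <-] := prefix_surj t => Bt.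
- by have : (prefix n @^-1` B) w by []; rewrite BC.
- by have : (prefix n @^-1` C) w by []; rewrite -BC.
Qed.

Lemma level_le n m A : (n <= m)%N -> level n A -> level m A.
Proof.
move=> nm [B mB ->].
pose trunc (t : m.-tuple S) : n.-tuple S := [tuple nth point t i | i < n].
exists (trunc @^-1` B).
  rewrite -[X in measurable X]setTI.
  have mtrunc : measurable_fun [set: m.-tuple S] trunc.
    apply/measurable_fun_tnthP => i.
    have im : (i < m)%N by exact: leq_trans nm.
    rewrite (_ : _ \o _ = @tnth _ S ^~ (Ordinal im)); first exact: measurable_tnth.
    by apply/funext => t /=; rewrite tnth_mktuple (tnth_nth point).
  exact: mtrunc.
rewrite -comp_preimage (_ : trunc \o prefix m = prefix n)//; apply/funext => w /=.
apply: eq_from_tnth => i; rewrite !tnth_mktuple.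
have im : (i < m)%N by exact: leq_trans nm.
by rewrite -[RHS](tnth_mktuple w (Ordinal im)) (tnth_nth point).
Qed.

Lemma levelC n A : level n A -> level n (~` A).
Proof. by move=> [B mB ->]; exists (~` B) => //; exact: measurableC. Qed.

Lemma levelU n A1 A2 : level n A1 -> level n A2 -> level n (A1 `|` A2).
Proof.
by move=> [B mB ->] [C mC ->]; exists (B `|` C) => //; exact: measurableU.
Qed.

Lemma cylinder_level2 A1 A2 : cylinder A1 -> cylinder A2 ->
  exists n, level n A1 /\ level n A2.
Proof.
move=> [n An] [m Am]; exists (maxn n m); split.
- exact: level_le (leq_maxl _ _) An.
- exact: level_le (leq_maxr _ _) Am.
Qed.

Lemma cylinder0 : cylinder set0.
Proof. by exists 0%N, set0. Qed.

Lemma cylinderU : setU_closed cylinder.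
Proof.
move=> A1 A2 c1 c2; have [n [l1 l2]] := cylinder_level2 c1 c2.
by exists n; exact: levelU.
Qed.

Lemma cylinderC : setC_closed cylinder.
Proof. by move=> A [n An]; exists n; exact: levelC. Qed.

Lemma level_ssection n A x : level n.+1 A -> level n (ssection A x).
Proof.
move=> [B mB ->]; exists [set t | B (cons_pair (x, t))].
  exact: measurable_tuple_section.
by apply/seteqP; split => w; rewrite /ssection/= prefix_scons.
Qed.

Lemma cylinder_ssection A x : cylinder A -> cylinder (ssection A x).
Proof.
by move=> [n /(level_le (leqnSn n)) An]; exists n; exact: level_ssection.
Qed.

Lemma level0P A : level 0 A -> A = set0 \/ A = setT.
Proof.
move=> [B _ ->]; have [B0|B0] := pselect (B [tuple]); [right|left].
- by apply/seteqP; split => // w _; rewrite /preimage/= (tuple0 (prefix 0 w)).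
- by apply/seteqP; split => // w; rewrite /preimage/= (tuple0 (prefix 0 w)).
Qed.

End cylinders.

Definition cylinder_algebra d (S : measurableType d) := nat -> S.

Definition cylinder_display : measure_display -> measure_display.
Proof. exact. Qed.

HB.instance Definition _ d (S : measurableType d) :=
  Pointed.on (cylinder_algebra S).
HB.instance Definition _ d (S : measurableType d) :=
  @isAlgebraOfSets.Build (cylinder_display d) (cylinder_algebra S)
    (@cylinder d S) cylinder0 cylinderU cylinderC.

(* [S^oo] with the product sigma-algebra, generated by the cylinders. *)
Definition sequence_space d (S : measurableType d) :=
  g_sigma_algebraType (@measurable _ (cylinder_algebra S)).

HB.instance Definition _ d (S : measurableType d) :=
  Measurable.on (sequence_space S).

Lemma measurable_prefix d (S : measurableType d) n :
  measurable_fun [set: sequence_space S] (@prefix d S n).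
Proof.
by move=> _ B mB; rewrite setTI; apply: sub_sigma_algebra; exists n, B.
Qed.

Section infinite_power.
Context {d} {S : measurableType d} {R : realType}.
Variable P : probability S R.
Implicit Types (w : nat -> S) (A : set (nat -> S)).
Local Open Scope ereal_scope.

Lemma tuple_power_level n m (B : set (n.-tuple S)) (C : set (m.-tuple S)) :
  measurable B -> measurable C -> prefix n @^-1` B = prefix m @^-1` C ->
  tuple_power P n B = tuple_power P m C.
Proof.
have pT k (D : set (k.-tuple S)) : prefix k @^-1` D = setT -> tuple_power P k D = 1.
  move=> DT; rewrite (@preimage_prefix_inj _ _ k D setT)//.
  exact: probability_setT.
have p0 k (D : set (k.-tuple S)) : prefix k @^-1` D = set0 -> tuple_power P k D = 0.
  by move=> D0; rewrite (@preimage_prefix_inj _ _ k D set0)// measure0.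
elim: n m B C => [|n IH] m B C mB mC BC.
  have [B0|BT] : prefix 0 @^-1` B = set0 \/ prefix 0 @^-1` B = setT.
    by apply: level0P; exists B.
  - by rewrite (p0 _ _ B0) p0// -BC.
  - by rewrite (pT _ _ BT) pT// -BC.
case: m => [|m] in C mC BC *.
  have [C0|CT] : prefix 0 @^-1` C = set0 \/ prefix 0 @^-1` C = setT.
    by apply: level0P; exists C.
  - by rewrite (p0 _ _ C0) p0// BC.
  - by rewrite (pT _ _ CT) pT// BC.
rewrite !tuple_powerS//; apply: eq_integral => x _; apply: IH.
- exact: measurable_tuple_section.
- exact: measurable_tuple_section.
- apply/seteqP; split => w; rewrite /preimage/= -!prefix_scons.
  + by move=> Bw; have : (prefix n.+1 @^-1` B) (scons x w) by []; rewrite BC.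
  + by move=> Cw; have : (prefix m.+1 @^-1` C) (scons x w) by []; rewrite -BC.
Qed.

Definition cylinder_prob A : \bar R :=
  xget 0 [set p | exists n, exists2 B : set (n.-tuple S),
    measurable B & A = prefix n @^-1` B /\ p = tuple_power P n B].

Lemma cylinder_probE n (B : set (n.-tuple S)) : measurable B ->
  cylinder_prob (prefix n @^-1` B) = tuple_power P n B.
Proof.
move=> mB; rewrite /cylinder_prob; case: xgetP => [p _ [m [C mC [BC ->]]]|].
  exact: tuple_power_level.
by move=> /(_ (tuple_power P n B))[]; exists n, B.
Qed.

Lemma cylinder_prob0 : cylinder_prob set0 = 0.
Proof. by rewrite -(preimage_set0 (prefix 0)) cylinder_probE. Qed.

Lemma cylinder_probT : cylinder_prob setT = 1.
Proof. by rewrite -(preimage_setT (prefix 0)) cylinder_probE// probability_setT. Qed.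

Lemma cylinder_prob_ge0 A : 0 <= cylinder_prob A.
Proof. by rewrite /cylinder_prob; case: xgetP => [p _ [n [B mB [_ ->]]]|]. Qed.

Lemma cylinder_probU A1 A2 : cylinder A1 -> cylinder A2 -> A1 `&` A2 = set0 ->
  cylinder_prob (A1 `|` A2) = cylinder_prob A1 + cylinder_prob A2.
Proof.
move=> c1 c2; have [n [[B mB ->] [C mC ->]]] := cylinder_level2 c1 c2.
rewrite -preimage_setI -(preimage_set0 (prefix n)) => /preimage_prefix_inj BC.
rewrite -preimage_setU !cylinder_probE//; last exact: measurableU.
by rewrite measureU.
Qed.

Lemma cylinder_prob_le A1 A2 : cylinder A1 -> cylinder A2 -> A1 `<=` A2 ->
  cylinder_prob A1 <= cylinder_prob A2.
Proof.
move=> c1 c2 A12.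
have c21 : cylinder (A2 `\` A1).
  by rewrite setDE -(setCK A2) -setCU; apply: cylinderC; apply: cylinderU => //;
     exact: cylinderC.
rewrite -(setDUK A12) cylinder_probU ?setDIK//.
by rewrite leeDl// cylinder_prob_ge0.
Qed.

Lemma cylinder_prob_le1 A : cylinder A -> cylinder_prob A <= 1.
Proof.
move=> cA; rewrite -cylinder_probT; apply: cylinder_prob_le => //.
by rewrite -setC0; apply: cylinderC; exact: cylinder0.
Qed.

Lemma measurable_cylinder_prob_ssection A : cylinder A ->
  measurable_fun [set: S] (fun x => cylinder_prob (ssection A x)).
Proof.
move=> [n /(level_le (leqnSn n)) [B mB ->]].
rewrite (_ : (fun x => _) = (fun x => tuple_power P n [set t | B (cons_pair (x, t))])).
  exact: measurable_tuple_power_section.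
apply/funext => x; rewrite -cylinder_probE; last exact: measurable_tuple_section.
by congr cylinder_prob; apply/seteqP; split => w; rewrite /ssection/= prefix_scons.
Qed.

Lemma cylinder_prob_ssection A : cylinder A ->
  cylinder_prob A = \int[P]_x cylinder_prob (ssection A x).
Proof.
move=> [n /(level_le (leqnSn n)) [B mB ->]].
rewrite cylinder_probE// tuple_powerS//; apply: eq_integral => x _.
rewrite -cylinder_probE; last exact: measurable_tuple_section.
by congr cylinder_prob; apply/seteqP; split => w; rewrite /ssection/= prefix_scons.
Qed.

Let persistent (A : nat -> set (nat -> S)) :=
  [/\ forall k, cylinder (A k), forall k, A k.+1 `<=` A k &
      ~ (cylinder_prob (A k) @[k --> \oo] --> 0)].

Let persistent_ssection (A : nat -> set (nat -> S)) : persistent A ->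
  exists x, persistent (fun k => ssection (A k) x).
Proof.
move=> [cA dA nA]; apply: contrapT => /forallNP nx; apply: nA.
have cvg0 x : cylinder_prob (ssection (A k) x) @[k --> \oo] --> 0.
  apply: contrapT => ncvg; apply: (nx x); split => //.
  - by move=> k; exact: cylinder_ssection.
  - by move=> k w; exact: dA.
under eq_fun do rewrite cylinder_prob_ssection//.
rewrite -(@integral0 _ _ R P setT).
apply: (@dominated_cvg _ _ _ P setT measurableT
  (fun k x => cylinder_prob (ssection (A k) x)) (cst 0) (cst 1)) => //.
- by move=> k; exact: measurable_cylinder_prob_ssection.
- by move=> x _; exact: cvg0.
- exact: (finite_measure_integrable_cst P 1%R measurableT).
- move=> k x _; rewrite gee0_abs ?cylinder_prob_ge0//.
  by apply: cylinder_prob_le1; exact: cylinder_ssection.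
Qed.

Let persistent_level0 (A : nat -> set (nat -> S)) k :
  persistent A -> level 0 (A k) -> A k = setT.
Proof.
move=> [cA dA nA] /level0P[A0|//]; exfalso; apply: nA.
have Ak i : A (i + k)%N = set0.
  elim: i => [//|i IH]; rewrite -subset0 -IH; exact: dA.
rewrite -(cvg_shiftn k) (_ : (fun _ => _) = cst 0); first exact: cvg_cst.
by apply/funext => i; rewrite Ak cylinder_prob0.
Qed.

Let state := {A | persistent A}.
Let head (s : state) : S := projT1 (cid (persistent_ssection (svalP s))).
Let next (s : state) : state :=
  exist _ (fun k => ssection (sval s k) (head s))
    (projT2 (cid (persistent_ssection (svalP s)))).
Let path (s : state) : nat -> S := fun n => head (iter n next s).

Let path_scons s : path s = scons (head s) (path (next s)).
Proof. by apply/funext => -[//|n]; rewrite /path iterSr. Qed.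

Let path_in n s k : level n (sval s k) -> sval s k (path s).
Proof.
elim: n s k => [|n IH] s k.
  by move=> /(persistent_level0 (svalP s)) ->.
move=> ls; rewrite path_scons.
exact: (IH (next s) k (level_ssection _ ls)).
Qed.

Lemma cylinder_prob_cvg0 (A : nat -> set (nat -> S)) :
  (forall k, cylinder (A k)) -> (forall k, A k.+1 `<=` A k) ->
  \bigcap_k A k = set0 -> cylinder_prob (A k) @[k --> \oo] --> 0.
Proof.
move=> cA dA A0; apply: contrapT => nA.
have pA : persistent A by split.
suff : (\bigcap_k A k) (path (exist _ A pA)) by rewrite A0.
move=> k _; have [n An] := cA k.
exact: (path_in (s := exist _ A pA) An).
Qed.

Lemma cylinder_prob_bigsetU (F : nat -> set (nat -> S)) n :
  (forall i, cylinder (F i)) -> trivIset setT F ->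
  cylinder (\big[setU/set0]_(i < n) F i) /\
  cylinder_prob (\big[setU/set0]_(i < n) F i) =
    \sum_(0 <= i < n) cylinder_prob (F i).
Proof.
move=> cF tF; elim: n => [|n [cU IH]].
  by rewrite big_ord0 big_geq//; split; [exact: cylinder0|exact: cylinder_prob0].
rewrite big_ord_recr big_nat_recr//=; split; first exact: cylinderU.
rewrite cylinder_probU// ?IH//.
rewrite -bigcup_mkord setI_bigcupl; apply: bigcup0 => i /= ni.
by move/trivIsetP : tF; apply => //; rewrite neq_ltn ni.
Qed.

Lemma cylinder_prob_semi_sigma_additive :
  semi_sigma_additive (cylinder_prob : set (cylinder_algebra S) -> \bar R).
Proof.
move=> F mF tF mU.
have cF i : cylinder (F i) := mF i.
have cU : cylinder (\bigcup_i F i) := mU.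
pose G n := \big[setU/set0]_(i < n) F i.
have [cG GE] : (forall n, cylinder (G n)) /\
    forall n, cylinder_prob (G n) = \sum_(0 <= i < n) cylinder_prob (F i).
  by split => n; have [] := cylinder_prob_bigsetU n cF tF.
pose A n := \bigcup_i F i `\` G n.
have cA n : cylinder (A n).
  rewrite /A setDE -(setCK (\bigcup_i F i)) -setCU.
  by apply: cylinderC; apply: cylinderU => //; exact: cylinderC.
have GU n : G n `<=` \bigcup_i F i 
  by rewrite /G -bigcup_mkord => w [i _ Fiw]; exists i.
have A0 : cylinder_prob (A n) @[n --> \oo] --> 0.
  apply: cylinder_prob_cvg0 => //.
  - move=> n w [Uw Gw]; split => // Gnw; apply: Gw.
    by rewrite /G big_ord_recr/=; left.
  - rewrite -subset0 => w Aw; have [[i _ Fiw] _] := Aw 0%N I.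
    have [_] := Aw i.+1 I; apply.
    by rewrite /G big_ord_recr/=; right.
have fA n : cylinder_prob (A n) \is a fin_num.
  by rewrite ge0_fin_numE ?cylinder_prob_ge0// (le_lt_trans (cylinder_prob_le1 _))// ltry.
under eq_fun do rewrite -GE.
rewrite (_ : (fun n => _) = fun n => cylinder_prob (\bigcup_i F i) - cylinder_prob (A n)).
  rewrite -[X in nbhs X]sube0.
  apply: (cvgeB _ _ A0); first by rewrite fin_num_adde_defl// oppe0.
  exact: cvg_cst.
apply/funext => n; rewrite -{1}(setDUK (GU n)) cylinder_probU ?setDIK//.
  by rewrite addeK//; exact: fA.
exact: cA.
Qed.

Definition cylinder_measure : set (cylinder_algebra S) -> \bar R := cylinder_prob.

HB.instance Definition _ := isMeasure.Build _ _ _ cylinder_measure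
  cylinder_prob0 cylinder_prob_ge0 cylinder_prob_semi_sigma_additive.

(* [P^oo]: the extension of the finite-dimensional distributions [P^n] to the
   product sigma-algebra. *)
Definition sequence_power : set (sequence_space S) -> \bar R :=
  measure_extension cylinder_measure.

HB.instance Definition _ := Measure.on sequence_power.

Lemma sequence_powerE n (B : set (n.-tuple S)) : measurable B ->
  sequence_power (prefix n @^-1` B) = tuple_power P n B.
Proof.
move=> mB; rewrite /sequence_power /measure_extension measurable_mu_extE/=.
  exact: cylinder_probE.
by exists n, B.
Qed.

Lemma sequence_power_setT : sequence_power setT = 1.
Proof.
by rewrite -(preimage_setT (prefix 0)) sequence_powerE// probability_setT.
Qed.

HB.instance Definition _ := Measure_isProbability.Build _ _ _ sequence_power
  sequence_power_setT.

Lemma sequence_power_rect n (A : 'I_n -> set S) : (forall i, measurable (A i)) ->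
  sequence_power [set w | forall i : 'I_n, A i (w i)] = \prod_(i < n) P (A i).
Proof.
move=> mA; rewrite -tuple_power_rect// -sequence_powerE; last exact: measurable_rect.
congr sequence_power; apply/seteqP; split => w /= h i.
  by rewrite tnth_mktuple.
by have := h i; rewrite tnth_mktuple.
Qed.

Lemma sequence_power_unique (Q : probability (sequence_space S) R) :
  (forall n (B : set (n.-tuple S)), measurable B ->
    Q (prefix n @^-1` B) = tuple_power P n B) ->
  forall A : set (sequence_space S), measurable A -> Q A = sequence_power A.
Proof.
move=> QE A mA; apply/esym.
apply: (@measure_extension_unique _ _ _ cylinder_measure) => //.
  exists (fun=> setT); first by rewrite bigcup_const.
  move=> i; split => //; rewrite (_ : _ setT = 1) ?ltry//; exact: cylinder_probT.
move=> X [n [B mB ->]]; transitivity (tuple_power P n B).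
  exact: cylinder_probE.
by apply/esym; exact: QE.
Qed.

End infinite_power.

Section measurable_majorant.
Context {d} {T : measurableType d} {R : realType}.
Variable Q : probability T R.
Implicit Types g h : T -> \bar R.
Local Open Scope ereal_scope.

Definition is_cover_function g h :=
  [/\ measurable_fun [set: T] h,
      forall x, g x <= h x &
      forall h', measurable_fun [set: T] h' ->
        {ae Q, forall x, g x <= h' x} -> {ae Q, forall x, h x <= h' x}].

(* A fixed version of [g^*]; [cover_functionP] shows that the default value is
   never used. *)
Definition cover_function g : T -> \bar R :=
  xget (cst +oo) [set h | is_cover_function g h].

Let ereal_between_rat (a b : \bar R) : a < b ->
  exists q : rat, a <= (ratr q)%:E /\ (ratr q)%:E < b.
Proof.
move: a b => [a| |] [b| |]//.
- rewrite lte_fin => /rat_in_itvoo[q]; rewrite in_itv/= => /andP[aq qb].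
  by exists q; rewrite lee_fin lte_fin ltW.
- move=> _; have /rat_in_itvoo[q] : (a < a + 1)%R by rewrite ltrDl.
  by rewrite in_itv/= => /andP[aq _]; exists q; rewrite lee_fin ltW// ltry.
- move=> _; have /rat_in_itvoo[q] : (b - 1 < b)%R by rewrite gtrBl.
  by rewrite in_itv/= => /andP[_ qb]; exists q; rewrite leNye lte_fin.
- by move=> _; exists 0%R; rewrite leNye ltry.
Qed.

Lemma cover_function_exists g : exists h, is_cover_function g h.
Proof.
pose C := [set h | measurable_fun [set: T] h /\ forall x, g x <= h x].
have Coo : C (cst +oo) by split => // x; rewrite leey.
pose m (q : rat) := ereal_inf [set Q [set x | (ratr q)%:E < h x] | h in C].
have mset h (c : \bar R) : measurable_fun [set: T] h -> measurable [set x | c < h x].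
  by move=> mh; rewrite -[X in measurable X]setTI; exact: emeasurable_fun_o_infty.
have mfin q : m q \is a fin_num.
  rewrite ge0_fin_numE.
    apply: (@le_lt_trans _ _ (Q [set x | (ratr q)%:E < cst +oo x])).
      by apply: ereal_inf_lbound; exists (cst +oo).
    by rewrite (le_lt_trans (probability_le1 _ _)) ?ltry//; exact: mset.
  by apply: le_ereal_inf_tmp => _ [h _ <-].
have : forall qn : rat * nat, exists h, C h /\
    Q [set x | (ratr qn.1)%:E < h x] < m qn.1 + (qn.2.+1%:R^-1)%:E.
  move=> [q n]; have := @lb_ereal_inf_adherent R _ (n.+1%:R^-1) _ (mfin q).
  by rewrite invr_gt0 ltr0Sn => /(_ isT)[_ [h Ch <-] hlt]; exists h.
move=> /choice[F FP].
pose G k : T -> \bar R := if unpickle k is Some qn then F qn else cst +oo.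
have CG k : C (G k) by rewrite /G; case: unpickle => // qn; case: (FP qn).
pose h x := einfs (G ^~ x) 0%N.
have hG k x : h x <= G k x.
  by rewrite /h /einfs; apply: ereal_inf_lbound; exists k.
have hF qn x : h x <= F qn x by have := hG (pickle qn) x; rewrite /G pickleK.
have mh : measurable_fun [set: T] h.
  by apply: measurable_fun_einfs => k; case: (CG k).
have gh x : g x <= h x.
  by apply: le_ereal_inf_tmp => _ [k _ <-]; case: (CG k).
exists h; split=> // h' mh' [N [mN N0 gN]].
pose h2 x := if x \in N then +oo else h' x.
have mh2 : measurable_fun [set: T] h2.
  apply: measurable_fun_if => //; last exact: measurable_funTS.
  apply: (measurable_fun_bool true); rewrite setTI.
  by rewrite (_ : _ @^-1` _ = N)//; apply/seteqP; split => x /=; [exact: set_mem|exact: mem_set].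
have gh2 x : g x <= h2 x.
  rewrite /h2; case: ifPn => [_|]; first by rewrite leey.
  by rewrite notin_setE => Nx; apply: contrapT => ?; apply: Nx; exact: gN.
pose k x := mine (h x) (h2 x).
have mk : measurable_fun [set: T] k by exact: measurable_mine.
have Ck : C k by split => // x; rewrite le_min gh gh2.
pose D q := [set x | (ratr q)%:E < h x] `\` [set x | (ratr q)%:E < k x].
have mD q : measurable (D q) by apply: measurableD; exact: mset.
have D0 q : Q (D q) = 0.
  have kh : [set x | (ratr q)%:E < k x] `<=` [set x | (ratr q)%:E < h x].
    by move=> x /=; rewrite lt_min => /andP[].
  have le_hk : Q [set x | (ratr q)%:E < h x] <= Q [set x | (ratr q)%:E < k x].
    apply: (@le_trans _ _ (m q)); last by apply: ereal_inf_lbound; exists k.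
    apply/lee_addgt0Pr => e e0.
    have [n ne] : exists n, (n.+1%:R^-1 < e)%R.
      exists (Num.truncn (e^-1)%R); rewrite -[ltRHS]invrK ltf_pV2 ?posrE ?invr_gt0 ?ltr0Sn//.
      by rewrite truncnS_gt.
    apply: (@le_trans _ _ (Q [set x | (ratr q)%:E < F (q, n) x])).
      apply: le_measure; rewrite ?inE; [exact: mset| |].
        by apply: mset; case: (FP (q, n)) => -[].
      by move=> x /= /lt_le_trans; apply; exact: hF.
    have [_ /= /ltW/le_trans] := FP (q, n); apply.
    by rewrite leeD2l// lee_fin ltW.
  rewrite measureD; [|exact: mset|exact: mset|]; last first.
    by rewrite (le_lt_trans (probability_le1 _ _)) ?ltry//; exact: mset.
  rewrite setIidr//.
  rewrite [X in X - _](_ : _ = Q [set x | (ratr q)%:E < k x]).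
    by rewrite subee// fin_num_measure//; exact: mset.
  apply/eqP; rewrite eq_le le_hk/=.
  by apply: le_measure => //; rewrite inE; exact: mset.
have ND : Q.-negligible (N `|` \bigcup_i (if unpickle i is Some q then D q else set0)).
  apply: negligibleU; first by exists N; split.
  apply: negligible_bigcup => i; case: unpickle => [q|]; last exact: negligible_set0.
  by exists (D q); split; [exact: mD|exact: D0|by []].
apply: negligibleS ND => x /= /negP; rewrite -ltNge => h'h.
have [Nx|Nx] := pselect (N x); [by left|right].
have [q [hq qh]] := ereal_between_rat h'h.
exists (pickle q) => //; rewrite pickleK; split => //=.
apply/negP; rewrite -leNgt /k ge_min; apply/orP; right.
by rewrite /h2 memNset.
Qed.

Lemma cover_functionP g : is_cover_function g (cover_function g).
Proof.
rewrite /cover_function; case: xgetP => [h _ //|nh].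
by have [h hP] := cover_function_exists g; have := nh h hP.
Qed.

End measurable_majorant.

Section glivenko_cantelli.
Context {d} {S : measurableType d} {R : realType}.
Implicit Types (H : set (S -> R)) (P : probability S R).

(* Junk value for [n = 0]: the zero measure. *)
Definition empirical_measure n (s : n.-tuple S) : {measure set S -> \bar R} :=
  mscale (n%:R^-1)%:nng (msum (fun i => \d_(nth point s i)) n).

Lemma Rintegral_empirical_measure n (s : n.-tuple S) (f : S -> R) :
  measurable_fun [set: S] f ->
  \int[empirical_measure s]_x f x = n%:R^-1 * \sum_(i < n) f (tnth s i).
Proof.
move=> mf.
have ge0E (g : S -> R) : measurable_fun [set: S] g -> (forall x, 0 <= g x) ->
    (\int[empirical_measure s]_x (g x)%:E =
     (n%:R^-1 * \sum_(i < n) g (tnth s i))%:E)%E.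
  move=> mg g0; have mg' : measurable_fun [set: S] (EFin \o g) by exact/measurable_EFinP.
  rewrite ge0_integral_mscale//; last by move=> x _; rewrite lee_fin.
  rewrite ge0_integral_measure_sum//; last by move=> x _; rewrite lee_fin.
  rewrite EFinM -sumEFin; congr (_ * _)%E; apply: eq_bigr => i _.
  by rewrite integral_dirac//= diracT mul1e (tnth_nth point).
have mp : measurable_fun [set: S] f^\+ by exact: measurable_funrpos.
have mn : measurable_fun [set: S] f^\- by exact: measurable_funrneg.
move: (empirical_measure s) ge0E => mu ge0E.
rewrite /Rintegral integralE.
have -> : ((fun x => (f x)%:E)^\+)%E = EFin \o f^\+.
  by apply/funext => x; rewrite funeposE /funrpos /= EFin_max.
have -> : ((fun x => (f x)%:E)^\-)%E = EFin \o f^\-.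
  by apply/funext => x; rewrite funenegE /funrneg /= EFin_max EFinN.
rewrite (ge0E _ mp (@funrpos_ge0 _ _ f)) (ge0E _ mn (@funrneg_ge0 _ _ f)).
have fE x : f x = f^\+ x - f^\- x by rewrite -[in LHS](funrposBneg f).
rewrite (eq_bigr _ (fun i _ => fE (tnth s i))) sumrB mulrBr.
by [].
Qed.

(* [||F||_H] for a functional [F]. *)
Definition functional_norm H (F : (S -> R) -> R) : \bar R :=
  ereal_sup [set `|F f|%:E | f in H].

(* [||P_n - P||_H] as a function of the sample. *)
Definition deviation H P n (s : n.-tuple S) : \bar R :=
  functional_norm H (fun f => \int[empirical_measure s]_x f x - \int[P]_x f x).

Definition deviation_cover H P n : n.-tuple S -> \bar R :=
  cover_function (tuple_power P n) (deviation H P (n := n)).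

Definition weak_uniform_Glivenko_Cantelli H :=
  forall eps : R, 0 < eps ->
    ereal_sup [set tuple_power P n [set s | (eps%:E < deviation_cover H P s)%E]
              | P in [set: probability S R]] @[n --> \oo] --> 0%E.

Definition strong_uniform_Glivenko_Cantelli H :=
  forall eps : R, 0 < eps ->
    ereal_sup [set sequence_power P
        [set w : sequence_space S |
          (eps%:E < ereal_sup [set deviation_cover H P (prefix k w)
                              | k in [set k | (n <= k)%N]])%E]
              | P in [set: probability S R]] @[n --> \oo] --> 0%E.

End glivenko_cantelli.

(* Main.v *)
(** The oscillations of the functions in [H] are uniformly bounded, by [M] say:
    for [n] odd and [P = (delta_x + delta_y) / 2], the point [x] cannot have
    empirical frequency exactly [1/2], so that [||P_n - P||_H] is at least
    [|f x - f y| / 2n] almost surely.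

    Fix a block length [m] such that [P^m {||P_m - P||_H^* > e}] is at most
    [a = 4^-K] for all [P], and cut a sample of size [n] into [q = n %/ m] blocks
    and a remainder. The events "[||P_m - P||_H^* > e] on the j-th block" are
    measurable and independent, so at least [b] of them occur with probability at
    most [2^q a^b], which is at most [2^-q] for [b > q / K]. When fewer occur,
    averaging over the blocks gives [||P_n - P||_H <= e + M/K + mM/n <= 3e] for
    [K] and [n] large. Hence [P^n {||P_n - P||_H^* > 3e} <= 2^-(n %/ m)] uniformly
    in [P], which is summable in [n]. *)
From Pilot Require Import Defs.
From HB Require Import structures.
From mathcomp Require Import all_boot all_order all_algebra.
From mathcomp Require Import all_classical all_reals all_analysis.
From mathcomp Require Import measurable_realfun ring lra.

Set Implicit Arguments.
Unset Strict Implicit.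
Unset Printing Implicit Defensive.

Import Order.TTheory GRing.Theory Num.Theory.
Import numFieldNormedType.Exports.
(* [Defs.prefix] is shadowed by [seq.prefix] otherwise. *)
Import Pilot.Defs.

Local Open Scope classical_set_scope.
Local Open Scope ring_scope.

(** * Consecutive blocks of a sequence and the events that count them *)

Section blocks.
Context {d} {S : measurableType d}.
Implicit Types (w : nat -> S) (C : set (nat -> S)).

Definition shift m w : nat -> S := fun i => w (m + i)%N.

Lemma level_shift m k C : level k C -> level (m + k) (shift m @^-1` C).
Proof.
move=> [B mB ->].
pose trunc (t : (m + k).-tuple S) : k.-tuple S := [tuple tnth t (rshift m i) | i < k].
exists (trunc @^-1` B).
  rewrite -[X in measurable X]setTI.
  have mtrunc : measurable_fun [set: (m + k).-tuple S] trunc.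
    apply/measurable_fun_tnthP => i.
    rewrite (_ : _ \o _ = @tnth _ S ^~ (rshift m i)); first exact: measurable_tnth.
    by apply/funext => t /=; rewrite tnth_mktuple.
  exact: mtrunc.
have E w : trunc (prefix (m + k) w) = prefix k (shift m w).
  by apply: eq_from_tnth => i; rewrite !tnth_mktuple.
by apply/funext => w; rewrite /preimage/= E.
Qed.

Lemma cylinder_prefix m (A : set (m.-tuple S)) : measurable A ->
  cylinder (prefix m @^-1` A).
Proof. by move=> mA; exists m, A. Qed.

Lemma cylinder_shift m C : cylinder C -> cylinder (shift m @^-1` C).
Proof. by move=> [k lC]; exists (m + k)%N; exact: level_shift. Qed.

Lemma cylinderI C1 C2 : cylinder C1 -> cylinder C2 -> cylinder (C1 `&` C2).
Proof.
move=> c1 c2; rewrite -(setCK C1) -(setCK C2) -setCU.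
by apply: cylinderC; apply: cylinderU; exact: cylinderC.
Qed.

(** Along an infinite sequence the blocks after the first are the blocks of [shift m w], so that no
    casts between tuple lengths arise. *)
Fixpoint hits m (A : set (m.-tuple S)) q w : nat :=
  if q is q'.+1 then ((prefix m w \in A) + hits A q' (shift m w))%N else 0%N.

Definition hits_ge m (A : set (m.-tuple S)) q b : set (nat -> S) :=
  [set w | (b <= hits A q w)%N].

(** The union is not disjoint: its second part leaves the first block free, and so depends on the
    later blocks only. *)
Lemma hits_geSS m (A : set (m.-tuple S)) q b :
  hits_ge A q.+1 b.+1 =
  (prefix m @^-1` A `&` shift m @^-1` hits_ge A q b) `|`
    shift m @^-1` hits_ge A q b.+1.
Proof.
apply/seteqP; split => w; rewrite /hits_ge /=.
  case: (boolP (prefix m w \in A)) => [/set_mem Aw|_]; rewrite ?add1n ?add0n => h.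
    by left.
  by right.
case=> [[Aw bw]|bw]; first by rewrite (mem_set Aw) add1n.
exact: leq_trans bw (leq_addl _ _).
Qed.

(** The explicit level [q * m] makes this an event about samples of any size [n >= q * m]. *)
Lemma level_hits_ge m (A : set (m.-tuple S)) q b : measurable A ->
  level (q * m) (hits_ge A q b).
Proof.
move=> mA; elim: q b => [|q IH] [|b].
- by exists setT => //; apply/seteqP; split.
- by exists set0 => //; apply/seteqP; split.
- by exists setT => //; apply/seteqP; split.
rewrite hits_geSS mulSn; apply: levelU; last exact: level_shift.
rewrite -(setCK (_ `&` _)) setCI; apply/levelC/levelU; apply: levelC; last exact: level_shift.
by apply: (level_le (leq_addr _ _)); exists A.
Qed.

End blocks.

(** * Independence of blocks and the tail of the number of hits *)

Section block_probability.
Context {d} {S : measurableType d} {R : realType}.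
Variable P : probability S R.
Implicit Types (C : set (nat -> S)).
Local Open Scope ereal_scope.

(** Independence of the first [m] coordinates from the others. Induction on [m] integrates out the
    first coordinate; for [m = 0] the event on the prefix is empty or sure. *)
Lemma cylinder_prob_block m (A : set (m.-tuple S)) C :
  measurable A -> cylinder C ->
  cylinder_prob P (prefix m @^-1` A `&` shift m @^-1` C) =
  tuple_power P m A * cylinder_prob P C.
Proof.
elim: m A => [|m IH] A mA cC.
  have [A0|AT] : prefix 0 @^-1` A = set0 \/ prefix 0 @^-1` A = setT.
  - by apply: level0P; exists A.
  - by rewrite -cylinder_probE// A0 set0I cylinder_prob0 mul0e.
  - by rewrite -cylinder_probE// AT setTI cylinder_probT mul1e.
rewrite cylinder_prob_ssection; last first.
  by apply: cylinderI; [exact: cylinder_prefix|exact: cylinder_shift].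
rewrite tuple_powerS// -ge0_integralZr//; last 2 first.
- exact: measurable_tuple_power_section.
- exact: cylinder_prob_ge0.
apply: eq_integral => x _; rewrite -IH//; last exact: measurable_tuple_section.
congr cylinder_prob; apply/seteqP; split => w;
  by rewrite /ssection/= prefix_scons.
Qed.

Lemma cylinder_probU_le C1 C2 : cylinder C1 -> cylinder C2 ->
  cylinder_prob P (C1 `|` C2) <= cylinder_prob P C1 + cylinder_prob P C2.
Proof. by move=> c1 c2; exact: (measureU2 (cylinder_measure P)). Qed.

(* The bound is that of the union over all choices of [b] of the [q] blocks, since
   ['C(q, b) <= 2 ^ q]; the recursion on [q] avoids the choices. *)
Lemma cylinder_prob_hits_ge m (A : set (m.-tuple S)) (a : R) q b :
  measurable A -> (0 <= a)%R -> tuple_power P m A <= a%:E ->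
  cylinder_prob P (hits_ge A q b) <= (2 ^+ q * a ^+ b)%:E.
Proof.
move=> mA a0 PA.
have cE k j : cylinder (hits_ge A k j) by exists (k * m)%N; exact: level_hits_ge.
elim: q b => [|q IH] [|b].
- by rewrite !expr0 mul1r cylinder_prob_le1.
- rewrite (_ : hits_ge _ _ _ = set0) ?cylinder_prob0; last by apply/seteqP; split.
  by rewrite lee_fin mul1r exprn_ge0.
- by apply: (le_trans (cylinder_prob_le1 _ (cE _ _))); rewrite lee_fin expr0 mulr1 exprn_ege1// ler1n.
rewrite hits_geSS; apply: le_trans (cylinder_probU_le _ _) _.
- by apply: cylinderI; [exact: cylinder_prefix|exact: cylinder_shift].
- exact: cylinder_shift.
rewrite cylinder_prob_block//.
(* Shift invariance is independence with a sure first block. *)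
have -> : cylinder_prob P (shift m @^-1` hits_ge A q b.+1) = cylinder_prob P (hits_ge A q b.+1).
  have := @cylinder_prob_block m setT _ measurableT (cE q b.+1).
  by rewrite preimage_setT setTI probability_setT mul1e.
have -> : (2 ^+ q.+1 * a ^+ b.+1 = a * (2 ^+ q * a ^+ b) + 2 ^+ q * a ^+ b.+1)%R.
  by rewrite !exprS; ring.
rewrite EFinD EFinM leeD//; apply: lee_pmul => //.
exact: cylinder_prob_ge0.
Qed.

End block_probability.

(** * Sums over a sample cut into blocks *)

Lemma normr_sum_ord_le (R : realDomainType) n (F : 'I_n -> R) (M : R) :
  (forall i, `|F i| <= M) -> `|\sum_(i < n) F i| <= n%:R * M.
Proof.
move=> FM; apply: (le_trans (ler_norm_sum _ _ _)).
have -> : n%:R * M = \sum_(i < n) M by rewrite sumr_const card_ord mulr_natl.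
by apply: ler_sum => i _; exact: FM.
Qed.

Section block_sums.
Context {d} {S : measurableType d} {R : realType}.
Implicit Types (g : S -> R) (w : nat -> S).

(** Every block is charged [m * e] and each block in [A] a further [m * M], so that only the number
    of hits matters. *)
Lemma normr_sum_blocks_le g m (A : set (m.-tuple S)) (e M : R) q w :
  (forall t : m.-tuple S, ~ A t -> `|\sum_(i < m) g (tnth t i)| <= m%:R * e) ->
  (forall x, `|g x| <= M) -> 0 <= e ->
  `|\sum_(i < q * m) g (w i)| <= m%:R * (q%:R * e + (hits A q w)%:R * M).
Proof.
move=> gA gM e0; elim: q w => [|q IH] w.
  by rewrite mul0n big_ord0 normr0 !mul0r addr0 mulr0.
rewrite mulSn big_split_ord /= (le_trans (ler_normD _ _))//.
have {}IH := IH (shift m w).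
have gS : `|\sum_(i < m) g (w i)| <= m%:R * (e + (prefix m w \in A)%:R * M).
  case: (boolP (prefix m w \in A)) => [_|/negP nA]; last first.
    rewrite mul0r addr0; apply: le_trans (gA (prefix m w) _).
      by under [X in _ <= `|X|]eq_bigr do rewrite tnth_mktuple.
    by move=> Aw; apply: nA; exact: mem_set.
  rewrite mul1r mulrDr -[leLHS]add0r lerD ?mulr_ge0//.
  by apply: normr_sum_ord_le => i; exact: gM.
apply: le_trans (lerD gS IH) _.
by rewrite natrD -natr1 le_eqVlt; apply/orP; left; apply/eqP; ring.
Qed.

Lemma normr_sum_le g m (A : set (m.-tuple S)) (e M : R) n w : (0 < m)%N ->
  (forall t : m.-tuple S, ~ A t -> `|\sum_(i < m) g (tnth t i)| <= m%:R * e) ->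
  (forall x, `|g x| <= M) -> 0 <= e ->
  `|\sum_(i < n) g (w i)| <=
    m%:R * ((n %/ m)%:R * e + (hits A (n %/ m) w)%:R * M) + m%:R * M.
Proof.
move=> m0 gA gM e0.
rewrite -(big_mkord xpredT (fun i => g (w i))) {1}(divn_eq n m) big_mkord big_split_ord /=.
rewrite (le_trans (ler_normD _ _))// lerD//; first exact: normr_sum_blocks_le.
(* The incomplete last block has fewer than [m] terms. *)
apply: le_trans (normr_sum_ord_le (M := M) _) _; first by move=> i; exact: gM.
rewrite ler_wpM2r//.
  exact: le_trans (normr_ge0 _) (gM point).
by rewrite ler_nat ltnW// ltn_mod.
Qed.

End block_sums.

(** * Tail bounds for the deviation under a fixed [P] *)

Section deviation_bounds.
Context {d} {S : measurableType d} {R : realType}.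
Variables (H : set (S -> R)) (P : probability S R).
Hypothesis intH : forall f, H f -> P.-integrable [set: S] (EFin \o f).

(** Multiplying by [n] turns the deviation into sums of centred values, which add up over blocks. *)
Lemma deviation_leP n (t : n.-tuple S) (e : R) : (0 < n)%N ->
  (deviation H P t <= e%:E)%E <->
  forall f, H f -> `|\sum_(i < n) (f (tnth t i) - \int[P]_x f x)| <= n%:R * e.
Proof.
move=> n0.
have nR : 0 < n%:R :> R by rewrite ltr0n.
have E f : H f -> `|\int[empirical_measure t]_x f x - \int[P]_x f x| =
    n%:R^-1 * `|\sum_(i < n) (f (tnth t i) - \int[P]_x f x)|.
  move=> Hf; rewrite Rintegral_empirical_measure; last first.
    by apply/measurable_EFinP; exact: measurable_int (intH Hf).
  rewrite -[n%:R^-1 in RHS]gtr0_norm ?invr_gt0// -normrM; congr `|_|.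
  rewrite sumrB sumr_const card_ord mulrBr; congr (_ - _).
  by rewrite -[X in _ * X]mulr_natl mulKf ?gt_eqF.
split=> [dev f Hf|le_f].
  rewrite -ler_pdivrMl// -E// -lee_fin (le_trans _ dev)//.
  by apply: ereal_sup_ubound; exists f.
apply: ge_ereal_sup => _ [f Hf <-].
by rewrite lee_fin E// ler_pdivrMl// le_f.
Qed.

(** The mean of [f] is an average of values that all lie within [M] of [f x]. *)
Lemma normr_centered_le (f : S -> R) (M : R) : H f ->
  (forall x y, `|f x - f y| <= M) -> forall x, `|f x - \int[P]_y f y| <= M.
Proof.
move=> Hf osc x.
have cE (c : R) : \int[P]_y c = c.
  rewrite (Rintegral_cst P measurableT).
  rewrite [X in fine X](_ : _ = 1%E) ?mulr1//; exact: probability_setT.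
have ci (c : R) : P.-integrable [set: S] (EFin \o cst c).
  exact: finite_measure_integrable_cst.
rewrite ler_distlC; apply/andP; split.
  rewrite -[leLHS]cE; apply: le_Rintegral => //; [exact: ci|exact: intH|].
  by move=> y _; have := osc x y; rewrite ler_distlC => /andP[].
rewrite -[leRHS]cE; apply: le_Rintegral => //; [exact: intH|exact: ci|].
by move=> y _; have := osc x y; rewrite ler_distlC => /andP[].
Qed.

Definition exceedance m (e : R) : set (m.-tuple S) :=
  [set t | (e%:E < deviation_cover H P t)%E].

Lemma measurable_exceedance m e : measurable (@exceedance m e).
Proof.
have [mh _ _] := cover_functionP (tuple_power P m) (@deviation _ _ _ H P m).
by rewrite /exceedance -[X in measurable X]setTI; exact: emeasurable_fun_o_infty.
Qed.

(** The function with value [+oo] on [B] and [e] elsewhere is a measurable majorant of the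
    deviation. The cover function is almost surely below it, hence exceeds [e] only on [B] and a
    null set. *)
Lemma tuple_power_exceedance_le n (B : set (n.-tuple S)) (e : R) :
  measurable B -> (forall t, ~ B t -> (deviation H P t <= e%:E)%E) ->
  (tuple_power P n (@exceedance n e) <= tuple_power P n B)%E.
Proof.
move=> mB devB.
have [mh _ minh] := cover_functionP (tuple_power P n) (@deviation _ _ _ H P n).
pose h (t : n.-tuple S) : \bar R := if t \in B then +oo%E else e%:E.
have mh' : measurable_fun [set: n.-tuple S] h.
  apply: measurable_fun_if => //; try exact: measurable_funTS.
  apply: (measurable_fun_bool true); rewrite setTI.
  by rewrite (_ : _ @^-1` _ = B)//; apply/seteqP; split => x /=; [exact: set_mem|exact: mem_set].
have [|N [mN N0 subN]] := minh h mh'.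
  apply/aeW => t; rewrite /h; case: ifPn => [_|/negP tB]; first by rewrite leey.
  by apply: devB => Bt; apply: tB; exact: mem_set.
have sub : exceedance e `<=` B `|` N.
  move=> t et; have [Bt|nBt] := pselect (B t); [by left|right].
  apply: subN => /=; rewrite /h memNset// => /(lt_le_trans et).
  by rewrite ltxx.
apply: le_trans (le_measure _ _ _ sub) _; rewrite ?inE.
- exact: measurable_exceedance.
- exact: measurableU.
apply: le_trans (measureU2 _ mB mN) _.
by rewrite [X in (_ + X <= _)%E](_ : _ = 0%E)// adde0.
Qed.

Lemma deviation_prefix_le m K n (e M : R) w : (0 < m)%N -> (0 < n)%N ->
  (forall f, H f -> forall x y, `|f x - f y| <= M) ->
  0 <= e -> 0 <= M -> M <= K%:R * e -> m%:R * M <= n%:R * e ->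
  (hits (@exceedance m e) (n %/ m) w <= n %/ m %/ K)%N ->
  (deviation H P (prefix n w) <= (3 * e)%:E)%E.
Proof.
move=> m0 n0 osc e0 M0 MK mM hitsK; apply/deviation_leP => // f Hf.
under eq_bigr do rewrite tnth_mktuple.
pose g x := f x - \int[P]_y f y.
have gA (t : m.-tuple S) : ~ exceedance e t -> `|\sum_(i < m) g (tnth t i)| <= m%:R * e.
  move=> /negP; rewrite -leNgt => te.
  have [_ dev _] := cover_functionP (tuple_power P m) (@deviation _ _ _ H P m).
  by have /deviation_leP := le_trans (dev t) te; exact.
have gM : forall x, `|g x| <= M by apply: normr_centered_le => //; exact: osc.
apply: le_trans (normr_sum_le n w m0 gA gM e0) _.
set q := (n %/ m)%N in hitsK *.
have hM : (hits (@exceedance m e) q w)%:R * M <= q%:R * e.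
  apply: (@le_trans _ _ ((q %/ K)%:R * M)); first by rewrite ler_wpM2r// ler_nat.
  apply: (@le_trans _ _ ((q %/ K)%:R * (K%:R * e))); first by rewrite ler_wpM2l.
  by rewrite mulrA -natrM ler_wpM2r// ler_nat leq_divM.
have mq : m%:R * (q%:R * e) <= n%:R * e.
  by rewrite mulrA -natrM ler_wpM2r// ler_nat mulnC leq_divM.
(* Three terms of size at most [n * e]: the charge [e] on all blocks, the extra [M] on the hit
   blocks, and the remainder. *)
have := ler_wpM2l (ler0n R m) hM; rewrite mulrDr; lra.
Qed.

Lemma tuple_power_exceedance_geometric m K n (e M : R) : (0 < m)%N -> (0 < n)%N ->
  (0 < K)%N ->
  (forall f, H f -> forall x y, `|f x - f y| <= M) ->
  0 <= e -> 0 <= M -> M <= K%:R * e -> m%:R * M <= n%:R * e ->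
  (tuple_power P m (@exceedance m e) <= (2^-1 ^+ K.*2)%:E)%E ->
  (tuple_power P n (@exceedance n (3 * e)) <= (2^-1 ^+ (n %/ m))%:E)%E.
Proof.
move=> m0 n0 K0 osc e0 M0 MK mM PA; set q := (n %/ m)%N.
have mA := measurable_exceedance (m := m) e.
(* With the successor, fewer than [b] hits means at most [q %/ K] hits, while [K * b > q]. *)
set b := (q %/ K).+1.
have [B mB BE] : level n (hits_ge (@exceedance m e) q b).
  by apply: level_le (level_hits_ge _ _ mA); exact: leq_divM.
apply: le_trans (tuple_power_exceedance_le mB _) _.
  move=> t nBt; have [w wt] := prefix_surj t; rewrite -wt.
  apply: (deviation_prefix_le (m := m) (K := K) (M := M)) => //.
  rewrite leqNgt; apply/negP => bw; apply: nBt; rewrite -wt.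
  by have : hits_ge (@exceedance m e) q b w by []; rewrite BE.
rewrite -cylinder_probE// -BE.
apply: le_trans (cylinder_prob_hits_ge q b mA _ PA) _; first by rewrite exprn_ge0.
(* Of the exponent [2 * K * b >= 2 * q], one [q] cancels the factor [2 ^ q] and the other gives the
   bound. *)
have qb : (q + q <= K.*2 * b)%N.
  by rewrite addnn -doubleMl leq_double mulnC ltnW// ltn_ceil.
rewrite lee_fin -exprM -(subnKC qb) !exprD -!mulrA.
rewrite [in leLHS]mulrA -exprMn mulfV// expr1n mul1r.
by rewrite ler_piMr ?exprn_ge0// exprn_ile1 ?invr_ge0 ?invf_le1 ?ler1n.
Qed.

End deviation_bounds.

(** * Uniformly bounded oscillation from two-point measures *)

Lemma normr_le_odd_signed_sum (R : realDomainType) n (F : 'I_n -> R) (c : R) :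
  odd n -> (forall i, F i = c \/ F i = - c) -> `|c| <= `|\sum_(i < n) F i|.
Proof.
move=> oddn Fc.
(* Here [k] counts the plus signs; for odd [n] the integer [2 * k - n] is nonzero, so its absolute
   value is at least 1. *)
have [k ->] : exists k : nat, \sum_(i < n) F i = c * ((k + k)%:R - n%:R).
  elim: n F {oddn} Fc => [|n IH] F Fc.
    by exists 0%N; rewrite big_ord0 subrr mulr0.
  have [k kE] := IH (fun i => F (lift ord0 i)) (fun i => Fc (lift ord0 i)).
  rewrite big_ord_recl kE.
  by case: (Fc ord0) => ->; [exists k.+1|exists k]; rewrite !natrD -?natr1; ring.
rewrite normrM ler_peMr//.
have : (k + k)%N != n by apply: contraTneq oddn => <-; rewrite addnn odd_double.
rewrite neq_ltn => /orP[] h; rewrite ler_normr; apply/orP; [right|left].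
  by rewrite opprB lerBrDr addrC natr1 ler_nat.
by rewrite lerBrDr addrC natr1 ler_nat.
Qed.

Section oscillation.
Context {d} {S : measurableType d} {R : realType}.
Implicit Types H : set (S -> R).

(** The measure [(delta_x + delta_y) / 2] is the empirical measure of the sample [x, y], whose
    integrals are already known. *)
Lemma two_point_probability (x y : S) : exists P : probability S R,
  (forall A, measurable A -> A x -> A y -> P A = 1%E) /\
  forall f, measurable_fun [set: S] f -> \int[P]_z f z = 2^-1 * (f x + f y).
Proof.
pose mu := @empirical_measure _ S R 2 [tuple x; y].
have mu1 (A : set S) : A x -> A y -> mu A = 1%E.
  move=> Ax Ay.
  transitivity ((2^-1 : R)%:E * \sum_(k < 2) \d_(nth point [:: x; y] k) A)%E; first by [].
  rewrite !big_ord_recl big_ord0/=.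
  by rewrite !diracE !mem_set// adde0 -EFinD -EFinM mulVf.
pose P : probability S R := HB.pack (mu : set S -> \bar R) (Measure.class mu)
  (Measure_isProbability.Build _ _ _ mu (mu1 [set: S] I I)).
exists P; split => [A _|f mf]; first exact: mu1.
rewrite (Rintegral_empirical_measure [tuple x; y] mf).
by rewrite !big_ord_recl big_ord0 addr0.
Qed.

Lemma weak_uniform_Glivenko_Cantelli_oscillation H :
  (forall f, H f -> forall P : probability S R, P.-integrable [set: S] (EFin \o f)) ->
  weak_uniform_Glivenko_Cantelli H ->
  exists2 M : R, 0 <= M & forall f, H f -> forall x y, `|f x - f y| <= M.
Proof.
move=> intH wGC.
have /(_ _ (@open_ereal_lt' R 0 1 lte01)) := wGC 1 ltr01.
(* The index [2 * N + 1] is odd and beyond [N]. *)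
move=> [N _ /(_ N.*2.+1)]; rewrite /= -addnn => /(_ (leqW (leq_addr _ _))).
set n := (N + N).+1; set p := ereal_sup _ => p1.
have n0 : (0 < n)%N by [].
(* Beyond this bound, [|f x - f y| / (2 * n)] exceeds the threshold 1. *)
exists (2 * n%:R); rewrite ?mulr_ge0// => f Hf x y; rewrite leNgt; apply/negP => far.
have [P [PA Pint]] := two_point_probability x y.
have mf : measurable_fun [set: S] f.
  by apply/measurable_EFinP; exact: measurable_int (intH f Hf P).
have intP g : H g -> P.-integrable [set: S] (EFin \o g) by move=> Hg; exact: intH.
(* Defined through the values of [f], because singletons of [S] need not be measurable. *)
pose A := [set z | f z = f x \/ f z = f y].
have mA : measurable A.
  rewrite (_ : A = f @^-1` [set f x; f y])// -[X in measurable X]setTI.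
  by apply: mf => //; apply: measurableU.
have : (tuple_power P n [set t | forall i, A (tnth t i)] <= p)%E.
  apply: (@le_trans _ _ (tuple_power P n (@exceedance _ _ _ H P n 1))); last first.
    by apply: ereal_sup_ubound; exists P.
  apply: le_measure; rewrite ?inE; [exact: (@measurable_rect _ _ n (fun=> A))|exact: measurable_exceedance|].
  move=> t At; rewrite /exceedance /=.
  have [_ dev _] := cover_functionP (tuple_power P n) (@deviation _ _ _ H P n).
  apply: lt_le_trans (dev t); rewrite ltNge; apply/negP => /(deviation_leP intP _ _ n0).
  move=> /(_ f Hf); apply/negP; rewrite -ltNge mulr1.
  apply: (@lt_le_trans _ _ `|(f x - f y) / 2|).
    by rewrite normrM [`|2^-1|]gtr0_norm// ltr_pdivlMr// mulrC.
  (* On this event each centred value is [(f x - f y) / 2] up to sign. *)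
  apply: normr_le_odd_signed_sum; first by rewrite /n addnn /= odd_double.
  by move=> i; rewrite Pint//; case: (At i) => ->; [left|right]; field.
rewrite (tuple_power_rect P (A := fun=> A))// big1 => [|i _]; last by apply: PA => //; [left|right].
by rewrite leNgt p1.
Qed.

End oscillation.

(** * Summation over the sample sizes and conclusion *)

Section strong_uniform_Glivenko_Cantelli.
Context {d} {S : measurableType d} {R : realType}.
Implicit Types H : set (S -> R).

(** Each power [2^-j] occurs [m] times, so the partial sums are at most [2 * m] and the tails
    vanish. *)
Lemma nneseries_geometric_divn_cvg0 m : (0 < m)%N ->
  (\sum_(n <= k <oo) (2^-1 ^+ (k %/ m))%:E)%E @[n --> \oo] --> (0 : \bar R).
Proof.
move=> m0.
have h0 k : (0 <= (2^-1 ^+ k : R)%:E)%E by rewrite lee_fin exprn_ge0.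
apply: (@nneseries_tail_cvg R (fun k => (2^-1 ^+ (k %/ m))%:E) xpredT); last by move=> k _.
have bound N : (\sum_(0 <= k < N * m) (2^-1 ^+ (k %/ m) : R)) = m%:R * (2 - 2 * 2^-1 ^+ N).
  elim: N => [|N IH]; first by rewrite mul0n big_geq// expr0 mulr1 subrr mulr0.
  rewrite (@big_cat_nat _ _ _ (N * m))//=; last by rewrite leq_mul2r leqnSn orbT.
  have -> : \sum_(N * m <= k < N.+1 * m) (2^-1 ^+ (k %/ m) : R) = m%:R * 2^-1 ^+ N.
    rewrite -{1}[(N * m)%N]add0n big_addn mulSn addnK.
    transitivity (\sum_(0 <= k < m) (2^-1 ^+ N : R)).
      apply: eq_big_nat => i /andP[_ im].
      by rewrite addnC divnMDl// divn_small// addn0.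
    by rewrite sumr_const_nat subn0 mulr_natl.
  by rewrite IH exprS; field.
apply: (@le_lt_trans _ _ (m%:R * 2 : R)%:E); last exact: ltry.
apply: lime_le; first by apply: is_cvg_nneseries => k _ _.
apply: nearW => N; rewrite sumEFin lee_fin.
apply: (@le_trans _ _ (\sum_(0 <= k < N * m) (2^-1 ^+ (k %/ m) : R))).
  rewrite [leRHS](@big_cat_nat _ _ _ N)//=; last by rewrite leq_pmulr.
  by rewrite lerDl sumr_ge0// => k _; rewrite exprn_ge0.
by rewrite bound ler_wpM2l// lerBlDr lerDl mulr_ge0// exprn_ge0.
Qed.

(** A supremum exceeds [e] exactly when some term does, so the event is a countable union of
    measurable events and subadditivity applies. *)
Lemma sequence_power_sup_exceedance_le H (P : probability S R) (e : R) n (u : nat -> \bar R) :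
  (forall k, 0 <= u k)%E ->
  (forall k, (n <= k)%N -> (tuple_power P k (@exceedance _ _ _ H P k e) <= u k)%E) ->
  (sequence_power P [set w : sequence_space S |
      (e%:E < ereal_sup [set deviation_cover H P (prefix k w)
                        | k in [set k | (n <= k)%N]])%E]
    <= \sum_(n <= k <oo) u k)%E.
Proof.
move=> u0 le_u.
set E := [set w : sequence_space S | _].
pose F k : set (sequence_space S) := prefix k @^-1` (@exceedance _ _ _ H P k e).
have mF k : measurable (F k).
  rewrite -[X in measurable X]setTI; apply: measurable_prefix => //.
  exact: measurable_exceedance.
have EF : E = \bigcup_(k in ~` `I_n) F k.
  apply/seteqP; split => [w /ereal_sup_gt[_ [k nk <-] ek]|w [k nk ek]].
    by exists k => //=; apply/negP; rewrite -leqNgt.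
  apply: lt_le_trans ek _; apply: ereal_sup_ubound; exists k => //=.
  by move/negP: nk; rewrite -leqNgt.
have mE : measurable E by rewrite EF; exact: bigcup_measurable.
apply: le_trans (measure_sigma_subadditive_tail (sequence_power P) mF mE _) _.
  by rewrite EF; exact: subset_refl.
have FE k : sequence_power P (F k) = tuple_power P k (@exceedance _ _ _ H P k e).
  by apply: sequence_powerE; exact: measurable_exceedance.
rewrite -[leLHS]nneseries_addn// -[leRHS]nneseries_addn//.
apply: lee_nneseries => [k _ _|k _]; first exact: measure_ge0.
by rewrite [leLHS]FE le_u// leq_addl.
Qed.

End strong_uniform_Glivenko_Cantelli.

Theorem mainTheorem1 (d : measure_display) (S : measurableType d)
    (R : realType) (H : set (S -> R)) :
  (forall f, H f ->
    forall P : probability S R, P.-integrable [set: S] (EFin \o f)) ->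
  (exists f, H f /\ ~ exists c, f = cst c) ->
  weak_uniform_Glivenko_Cantelli H ->
  strong_uniform_Glivenko_Cantelli H.
Proof.
move=> intH _ wGC eps eps0.
have [M M0 osc] := weak_uniform_Glivenko_Cantelli_oscillation intH wGC.
pose e := eps / 3.
have e0 : 0 < e by rewrite divr_gt0.
have epsE : eps = 3 * e by rewrite /e; field.
have archi (a b : R) : 0 < b -> exists2 k, (0 < k)%N & a <= k%:R * b.
  move=> b0; exists (Num.truncn (a / b)).+1 => //.
  by rewrite -ler_pdivrMr// ltW// truncnS_gt.
have [K K0 MK] := archi M e e0.
(* Apart from the bound on oscillations, the weak property is used for this single block length
   only. *)
have [m m0 Pm] : exists2 m, (0 < m)%N & forall P : probability S R,
    (tuple_power P m (@exceedance _ _ _ H P m e) <= (2^-1 ^+ K.*2)%:E)%E.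
  have h0 : (0 < (2^-1 ^+ K.*2 : R)%:E)%E by rewrite lte_fin exprn_gt0.
  have [N _ small] := wGC e e0 _ (open_ereal_lt' h0).
  (* The successor keeps the block length positive. *)
  exists N.+1 => // P; apply: le_trans (ltW (small N.+1 (leqnSn N))).
  by apply: ereal_sup_ubound; exists P.
have [n0 n00 mM] := archi (m%:R * M) e e0.
apply: (@squeeze_cvge _ _ _ _ (cst 0%E) _ (fun n => \sum_(n <= k <oo) (2^-1 ^+ (k %/ m))%:E)%E);
  [|exact: cvg_cst|exact: nneseries_geometric_divn_cvg0].
near=> n; apply/andP; split.
  (* The supremum over an empty family would be [-oo]; some probability measure exists because [S]
     has a [point]. *)
  have [P _] := two_point_probability (R := R) (point : S) point.
  apply: le_trans (ereal_sup_ubound _); last by exists P.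
  exact: measure_ge0.
apply: ge_ereal_sup => _ [P _ <-].
apply: sequence_power_sup_exceedance_le => [k|k nk]; first by rewrite lee_fin exprn_ge0.
rewrite epsE.
(* From [n0] on, the remainder term [m * M] is at most [k * e]. *)
have n0k : (n0 <= k)%N.
  by apply: leq_trans nk; near: n; exact: nbhs_infty_ge.
apply: (tuple_power_exceedance_geometric _ m0 _ K0 osc _ M0 MK) => //.
- by move=> f Hf; exact: intH.
- exact: leq_trans n0k.
- exact: ltW.
- by apply: (le_trans mM); rewrite ler_pM2r// ler_nat.
Unshelve. all: by end_near.
Qed.
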